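(* Let $\Bbbk$ be a field of characteristic zero and let $m\ge 3$ be an integer. Then the artinian algebra $A(T_{m,2})$ has the weak Lefschetz property if and only if $m\in\{4,5,7,8,11\}$.
   Context: For integers $m\ge 3$, $n\ge 1$, the tadpole graph $T_{m,n}$ is the simple graph with vertex set $\{x_1,\dots,x_m,y_1,\dots,y_n\}$ and edges $\{x_i,x_{i+1}\}$ for $1\le i\le m-1$, $\{x_m,x_1\}$ (so the $x_i$ form an $m$-cycle), $\{y_j,y_{j+1}\}$ for $1\le j\le n-1$ (so the $y_j$ form a path), and the bridge $\{x_m,y_1\}$. For a simple graph $G$ on vertices $1,\dots,N$, let $R=\Bbbk[x_1,\dots,x_N]$ be the standard graded polynomial ring, $I(G)=(x_ix_j : \{i,j\}\text{ an edge of }G)$ its edge ideal, and $A(G)=R/\big((x_1^2,\dots,x_N^2)+I(G)\big)$, a standard graded artinian algebra $A=\bigoplus_{j=0}^s [A]_j$. Such an $A$ has the weak Lefschetz property (WLP) if there is a linear form $\ell\in[A]_1$ such that multiplication $\times\ell:[A]_j\to[A]_{j+1}$ is injective or surjective for every $j=0,\dots,s-1$. *)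

(* Defs.v *)
From HB Require Import structures.
From mathcomp Require Import all_boot all_order all_algebra.
From mathcomp Require Import mpoly.
Set Implicit Arguments. Unset Strict Implicit. Unset Printing Implicit Defensive.
Import Order.TTheory GRing.Theory.
Local Open Scope ring_scope.

(* R = k[x_0, ..., x_{N-1}] is {mpoly k[N]}; a simple graph on the vertex set
   'I_N is given by its (symmetric, irreflexive) adjacency relation E. *)

Definition is_homog (k : fieldType) (N d : nat) (p : {mpoly k[N]}) : bool :=
  p \is @ishomog1 N k d (@mdeg N).

Definition in_J (k : fieldType) (N : nat) (E : rel 'I_N) (f : {mpoly k[N]}) : Prop :=
  exists (c : 'I_N -> {mpoly k[N]}) (e : 'I_N -> 'I_N -> {mpoly k[N]}),
    f = \sum_(i < N) c i * 'X_i ^+ 2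
        + \sum_(i < N) \sum_(j < N | E i j) e i j * ('X_i * 'X_j).

Definition linform (k : fieldType) (N : nat) (a : 'I_N -> k) : {mpoly k[N]} :=
  \sum_(i < N) a i *: 'X_i.

(* Since J(G) is homogeneous, [A(G)]_j = R_j / (J(G) ∩ R_j).
   Multiplication by l : [A]_j -> [A]_{j+1} is injective iff
   every f in R_j with l f in J(G) already lies in J(G). *)
Definition mult_injective (k : fieldType) (N : nat) (E : rel 'I_N)
    (l : {mpoly k[N]}) (j : nat) : Prop :=
  forall f : {mpoly k[N]}, is_homog j f -> in_J E (l * f) -> in_J E f.

Definition mult_surjective (k : fieldType) (N : nat) (E : rel 'I_N)
    (l : {mpoly k[N]}) (j : nat) : Prop :=
  forall g : {mpoly k[N]}, is_homog j.+1 g ->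
    exists f : {mpoly k[N]}, is_homog j f /\ in_J E (g - l * f).

(* A(G) has the WLP: some linear form l gives injective-or-surjective maps
   [A]_j -> [A]_{j+1} in every degree j.  (For j >= s, the socle degree,
   [A]_{j+1} = 0, so the condition is automatic there; quantifying over all
   j is therefore the same as over j = 0..s-1.) *)
Definition has_WLP (k : fieldType) (N : nat) (E : rel 'I_N) : Prop :=
  exists a : 'I_N -> k, forall j : nat,
    mult_injective E (linform a) j \/ mult_surjective E (linform a) j.

(* Tadpole graph T_{m,n} on 'I_(m+n): vertex x_i (1<=i<=m) is index i-1,
   vertex y_j (1<=j<=n) is index m+j-1. *)
Definition tadpole_arc (m : nat) (a b : nat) : bool :=
  ([|| (a < m) && (b < m) && (b == a.+1)
    , (a == m.-1) && (b == 0)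
    , (m <= a) && (b == a.+1)
    | (a == m.-1) && (b == m) ])%N.

Definition tadpole (m n : nat) : rel 'I_(m + n) :=
  fun u v => tadpole_arc m u v || tadpole_arc m v u.

Arguments has_WLP k {N} E.
Arguments tadpole m n : clear implicits.

(* Main.v *)
Require Import Defs.
From HB Require Import structures.
From Stdlib Require Import ZArith.
From mathcomp Require Import all_boot all_order all_algebra.
From mathcomp Require Import mpoly.
From mathcomp Require Import ring zify ssrZ.
Set Implicit Arguments. Unset Strict Implicit. Unset Printing Implicit Defensive.
Import Order.TTheory GRing.Theory.
Local Open Scope ring_scope.

(** Multiplication by a linear form is read on the vector spaces spanned by the
    stable sets of the graph. Suppose the vertices are covered by cliques, which are grouped
    into d pairs. Writing u_1, ..., u_2d for the sums of the variables over the
    cliques, u_i ^ 2 = 0 in A(G), hence l = u_1 + ... + u_2d kills the product of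
    the u_(2i-1) - u_2i, which has degree d. Dually, r pairs of vertices with no
    edge between distinct pairs give the product of the dual forms
    e_p - e_p', which is killed by the transpose of l, so that l is not onto in
    degree r. The spanning path x_1, ..., x_m, y_1, y_2 is covered by edges, which
    gives d = ceil ((m + 2) / 4) (for m = 3 a triangle and an edge give d = 1), and
    r = floor (m / 3) + 1 pairs exist. Both maximal rank conditions fail in
    degree d as soon as d < r, which holds exactly when m is not in the list. In
    the five remaining cases l = x_1 + ... + y_2 has maximal rank, by Gaussian
    elimination over the integers. *)

(** * Stable sets and squarefree monomials *)

Section StableSets.
Variables (N : nat) (E : rel 'I_N).
Implicit Types (i j : 'I_N) (S T : {set 'I_N}).

Definition stable S := [forall i in S, forall j in S, (i != j) ==> ~~ E i j].

Definition stable_sets d := [set S | stable S & #|S| == d].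

Lemma stableP S :
  reflect {in S &, forall i j, i != j -> ~~ E i j} (stable S).
Proof.
apply: (iffP forall_inP) => [st i j iS jS ij|st i iS].
  by have /forall_inP/(_ j jS)/implyP := st i iS; apply.
by apply/forall_inP => j jS; apply/implyP; apply: st.
Qed.

Lemma stableS S T : S \subset T -> stable T -> stable S.
Proof.
move=> /subsetP sST /stableP st; apply/stableP => i j iS jS.
by apply: st; apply: sST.
Qed.

Lemma stable_sets_setD1 d T i : T \in stable_sets d.+1 -> i \in T -> T :\ i \in stable_sets d.
Proof.
rewrite !inE => /andP[stT /eqP cT] iT; rewrite (stableS (subsetDl _ _) stT) /=.
by move: cT; rewrite (cardsD1 i) iT add1n => -[->].
Qed.

Lemma stable_sets_eq0_add d e : stable_sets d = set0 -> stable_sets (d + e)%N = set0.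
Proof.
move=> ind0; elim: e => [|e IHe]; first by rewrite addn0.
apply/setP => T; rewrite [RHS]in_set0 addnS.
apply/negP => TI; have /card_gt0P[i iT] : (0 < #|T|)%N.
  by move: TI; rewrite inE => /andP[_ /eqP->].
by have := stable_sets_setD1 TI iT; rewrite IHe in_set0.
Qed.

End StableSets.

Section StableMonomials.
Variables (k : fieldType) (N : nat) (E : rel 'I_N).
Implicit Types (i j : 'I_N) (S T : {set 'I_N}) (m : 'X_{1..N}) (f g : {mpoly k[N]}).
Implicit Types (a : 'I_N -> k) (c : {set 'I_N} -> k).

Definition mnm_set S : 'X_{1..N} := [multinom (i \in S : nat) | i < N].

Lemma mnm_set_inj : injective mnm_set.
Proof.
move=> S T /mnmP eqST; apply/setP => i; have := eqST i.
by rewrite !mnmE; case: (i \in S) (i \in T) => -[].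
Qed.

Lemma mdeg_mnm_set S : mdeg (mnm_set S) = #|S|.
Proof.
rewrite mdegE -sum1_card [RHS]big_mkcond /=; apply: eq_bigr => i _.
by rewrite mnmE; case: (i \in S).
Qed.

Lemma mcoeffMX_if f m1 m2 :
  (f * 'X_[m1])@_m2 = if (m1 <= m2)%MM then f@_(m2 - m1)%MM else 0.
Proof.
case: ifPn => [le12|nle12]; first by rewrite -{1}(submK le12) addmC mcoeffMX.
rewrite [f]mpolyE mulr_suml raddf_sum /= big1 // => m _.
rewrite -scalerAl -mpolyXD mcoeffZ mcoeffX; case: eqP => [eq12|]; last first.
  by rewrite mulr0.
by case/negP: nle12; rewrite -eq12 lem_addl.
Qed.

Lemma lem_mnm_set1 i S : (U_(i) <= mnm_set S)%MM = (i \in S).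
Proof.
apply/mnm_lepP/idP => [/(_ i)|iS j]; rewrite mnm1E ?eqxx mnmE.
  by case: (i \in S).
by case: eqP => [<-|//]; rewrite iS.
Qed.

Lemma mnm_setD1 i S : i \in S -> (mnm_set S - U_(i))%MM = mnm_set (S :\ i).
Proof.
move=> iS; apply/mnmP => j; rewrite mnmBE !mnmE !inE eq_sym.
by case: eqP => [->|_]; rewrite ?iS ?subn0.
Qed.

Lemma mcoeff_linformM a f T :
  (linform a * f)@_(mnm_set T) = \sum_(i in T) a i * f@_(mnm_set (T :\ i)).
Proof.
rewrite /linform mulr_suml raddf_sum [RHS]big_mkcond /=; apply: eq_bigr => i _.
rewrite -scalerAl mcoeffZ (mulrC 'X_i) mcoeffMX_if lem_mnm_set1.
by case: ifP => [iT|_]; rewrite ?mulr0 ?mnm_setD1.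
Qed.

Lemma in_J0 : in_J E (0 : {mpoly k[N]}).
Proof.
exists (fun _ => 0), (fun _ _ => 0); rewrite !big1 ?addr0 // => i _.
  by rewrite big1 // => j _; rewrite mul0r.
by rewrite mul0r.
Qed.

Lemma in_JD f g : in_J E f -> in_J E g -> in_J E (f + g).
Proof.
move=> [c [e ->]] [c' [e' ->]].
exists (fun i => c i + c' i), (fun i j => e i j + e' i j).
rewrite addrACA; congr (_ + _); rewrite -big_split; apply: eq_bigr => i _ /=.
  by rewrite mulrDl.
by rewrite -big_split /=; apply: eq_bigr => j _; rewrite mulrDl.
Qed.

Lemma in_J_sqr i f : in_J E (f * 'X_i ^+ 2).
Proof.
exists (fun j => if j == i then f else 0), (fun _ _ => 0).
rewrite (bigD1 i) //= eqxx big1 => [|j /negPf->]; last by rewrite mul0r.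
rewrite [X in _ + X]big1 ?addr0 // => j _.
by rewrite big1 // => l _; rewrite mul0r.
Qed.

Lemma in_J_edge i j f : E i j -> in_J E (f * ('X_i * 'X_j)).
Proof.
move=> Eij; exists (fun _ => 0).
exists (fun u v => if (u == i) && (v == j) then f else 0).
rewrite big1 ?add0r => [|l _]; last by rewrite mul0r.
rewrite (bigD1 i) //= (bigD1 j) //= !eqxx big1 => [|v /andP[_ /negPf->]].
  rewrite big1 ?addr0 // => u /negPf-> /=; rewrite big1 // => v _.
  by rewrite mul0r.
by rewrite andbF mul0r.
Qed.

(** The ideal is monomial, and none of its generators divides the squarefree monomial of a stable
    set. *)
Lemma in_J_mcoeff f T : in_J E f -> stable E T -> f@_(mnm_set T) = 0.
Proof.
move=> [c [e ->]] /stableP stT; rewrite mcoeffD !raddf_sum /=.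
rewrite !big1 ?addr0 // => i _ /=.
  rewrite raddf_sum big1 // => j Eij /=; rewrite -mpolyXD mcoeffMX_if.
  case: ifP => // /mnm_lepP le_T; case: (eqVneq i j) => [eq_ij|ne_ij].
    have := le_T i; rewrite -eq_ij mnmDE mnm1E eqxx mnmE.
    by case: (i \in T).
  have := le_T i; have := le_T j; rewrite !mnmDE !mnm1E !eqxx !mnmE.
  rewrite (eq_sym j) (negPf ne_ij) addn0 add0n.
  case jT: (j \in T) => //; case iT: (i \in T) => //.
  by have := stT _ _ iT jT ne_ij; rewrite Eij.
rewrite expr2 -mpolyXD mcoeffMX_if; case: ifP => // /mnm_lepP/(_ i).
by rewrite mnmDE mnm1E eqxx mnmE; case: (i \in T).
Qed.

(** A monomial not coming from a stable set has an exponent at least 2 or contains an edge, hence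
    lies in the ideal. With [in_J_mcoeff], the stable sets of size [d] thus index a basis of
    [A]_d. *)
Lemma mcoeff_in_J d f : is_homog d f ->
  (forall T, T \in stable_sets E d -> f@_(mnm_set T) = 0) -> in_J E f.
Proof.
move=> hf f0; rewrite [f]mpolyE big_seq; elim/big_ind: _.
- exact: in_J0.
- by move=> f1 f2; apply: in_JD.
move=> m mf; pose T := [set i | m i != 0%N].
have [/existsP[i m2]|/existsPn m_le1] := boolP [exists i, 1 < m i]%N.
  have le_m : (U_(i) + U_(i) <= m)%MM.
    apply/mnm_lepP => j; rewrite mnmDE mnm1E.
    by case: eqP => [<-|].
  rewrite -(submK le_m) !mpolyXD scalerAl -expr2.
  exact: in_J_sqr.
have mT : m = mnm_set T.
  apply/mnmP => i; rewrite mnmE inE; have := m_le1 i; lia.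
have [stT|] := boolP (stable E T).
  suff -> : f@_m = 0 by rewrite scale0r; apply: in_J0.
  rewrite mT f0 // inE stT -mdeg_mnm_set -mT /=.
  by apply/eqP; move/dhomogP: hf; apply.
case/forall_inPn => i iT /forall_inPn[j jT]; rewrite negb_imply negbK.
case/andP=> ij Eij; have le_m : (U_(i) + U_(j) <= m)%MM.
  apply/mnm_lepP => l; move: iT jT; rewrite mnmDE !mnm1E !inE.
  case: (eqVneq i l) => [<-|_] mi mj.
    by rewrite (eq_sym j) (negPf ij) addn0 lt0n.
  by case: eqP => [<-|//]; rewrite lt0n.
rewrite -(submK le_m) mpolyXD scalerAl mpolyXD.
exact: in_J_edge.
Qed.

End StableMonomials.

(** * Multiplication by a linear form as a matrix on stable sets *)

Section LinearAlgebra.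
Variables (k : fieldType) (N : nat) (E : rel 'I_N).
Implicit Types (i j : 'I_N) (S T : {set 'I_N}) (f g : {mpoly k[N]}).
Implicit Types (a : 'I_N -> k) (c D : {set 'I_N} -> k).
Local Notation stable_sets := (stable_sets E).

Definition setpoly d c : {mpoly k[N]} := \sum_(S in stable_sets d) c S *: 'X_[mnm_set S].

Lemma mcoeff_setpoly d c S : S \in stable_sets d -> (setpoly d c)@_(mnm_set S) = c S.
Proof.
move=> Sd; rewrite raddf_sum /= (bigD1 S) //= mcoeffZ mcoeffX eqxx mulr1.
rewrite big1 ?addr0 // => T /andP[_ /negPf neTS].
by rewrite mcoeffZ mcoeffX (inj_eq (@mnm_set_inj N)) neTS mulr0.
Qed.

Lemma setpoly_homog d c : is_homog d (setpoly d c).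
Proof.
apply: rpred_sum => S; rewrite inE => /andP[_ /eqP <-].
by apply: rpredZ; rewrite dhomogX /= mdeg_mnm_set.
Qed.

Lemma linformM_homog d a f : is_homog d f -> is_homog d.+1 (linform a * f).
Proof.
move=> hf; rewrite -add1n; apply: dhomogM => //; apply: rpred_sum => i _.
by apply: rpredZ; rewrite dhomogX /= mdeg1.
Qed.

(** With [c] the coordinates of a form of degree [d], the sum is the coordinate at [T] of its
    product with the linear form. *)
Lemma mult_injectiveP d a :
  mult_injective E (linform a) d <->
  (forall c, (forall T, T \in stable_sets d.+1 -> \sum_(i in T) a i * c (T :\ i) = 0) ->
     forall S, S \in stable_sets d -> c S = 0).
Proof.
split=> [inj c c0 S Sd | inj f hf lfJ].
  rewrite -(mcoeff_setpoly c Sd); apply: (in_J_mcoeff (E := E)); last first.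
    by move: Sd; rewrite inE => /andP[].
  apply: inj; first exact: setpoly_homog.
  apply: (mcoeff_in_J (d := d.+1)) => [|T Td].
    exact/linformM_homog/setpoly_homog.
  rewrite mcoeff_linformM -[RHS](c0 T Td); apply: eq_bigr => i iT.
  by rewrite mcoeff_setpoly // stable_sets_setD1.
apply: (mcoeff_in_J hf) => S; apply: (inj (fun S => f@_(mnm_set S))) => T Td.
rewrite -mcoeff_linformM; apply: in_J_mcoeff lfJ _.
by move: Td; rewrite inE => /andP[].
Qed.

(** The matrix of multiplication by the linear form in the bases of stable sets; at most one index
    contributes to an entry. *)
Definition incidence a S T := \sum_(i in T | T :\ i == S) a i.

Lemma sum_incidencel d a c T : T \in stable_sets d.+1 ->
  \sum_(S in stable_sets d) c S * incidence a S T = \sum_(i in T) a i * c (T :\ i).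
Proof.
move=> Td; under eq_bigr do rewrite mulr_sumr.
rewrite (exchange_big_dep (mem T)) /= => [|S i _ /andP[]//].
apply: eq_bigr => i iT; rewrite mulrC (big_pred1 (T :\ i)) // => S.
rewrite iT /= (eq_sym _ S) andbC; case: eqP => //= ->.
exact: stable_sets_setD1 Td iT.
Qed.

Lemma sum_incidencer d a D S : S \in stable_sets d ->
  \sum_(T in stable_sets d.+1) incidence a S T * D T =
  \sum_(i | (i \notin S) && (i |: S \in stable_sets d.+1)) a i * D (i |: S).
Proof.
move=> Sd; under eq_bigr do rewrite mulr_suml.
rewrite (exchange_big_dep (fun i => (i \notin S) && (i |: S \in stable_sets d.+1))) /=.
  apply: eq_bigr => i /andP[iS iSd]; rewrite (big_pred1 (i |: S)) // => T.
  apply/andP/eqP => [[_ /andP[iT /eqP<-]]|->]; first by rewrite setD1K.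
  by rewrite iSd setU11 setU1K /=.
by move=> T i Td /andP[iT /eqP<-]; rewrite setD11 setD1K.
Qed.

(** A linear map is onto exactly when its transpose is injective; [D] is a vector on the dual
    side. *)
Lemma mult_surjectiveP d a :
  mult_surjective E (linform a) d <->
  (forall D,
     (forall S, S \in stable_sets d ->
        \sum_(T in stable_sets d.+1) incidence a S T * D T = 0) ->
     forall T, T \in stable_sets d.+1 -> D T = 0).
Proof.
split=> [surj D D0 T Td | inj g hg].
  (* Each basis monomial is an image modulo the ideal, which turns [D T] into a combination of the
     vanishing sums. *)
  have [|f [hf gfJ]] := surj 'X_[mnm_set T].
    by rewrite /is_homog dhomogX /= mdeg_mnm_set; move: Td; rewrite inE => /andP[].
  have lf U : U \in stable_sets d.+1 ->
      (U == T)%:R = \sum_(S in stable_sets d) f@_(mnm_set S) * incidence a S U.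
    move=> Ud; rewrite (sum_incidencel a (fun S => f@_(mnm_set S))) // -mcoeff_linformM.
    have stU : stable E U by move: Ud; rewrite inE => /andP[].
    have /eqP := in_J_mcoeff gfJ stU.
    by rewrite mcoeffB mcoeffX (inj_eq (@mnm_set_inj N)) subr_eq0 (eq_sym T) => /eqP.
  have -> : D T = \sum_(U in stable_sets d.+1) (U == T)%:R * D U.
    rewrite (bigD1 T) //= eqxx mul1r big1 ?addr0 // => U /andP[_ /negPf->].
    by rewrite mul0r.
  under eq_bigr => U Ud do rewrite lf // mulr_suml.
  rewrite exchange_big big1 //= => S Sd.
  by under eq_bigr do rewrite -mulrA; rewrite -mulr_sumr D0 ?mulr0.
pose M := \matrix_(s < #|stable_sets d|, t < #|stable_sets d.+1|)
            incidence a (enum_val s) (enum_val t).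
have fullM : row_full M.
  rewrite /row_full -mxrank_tr; apply: inj_row_free => w wM0.
  (* A row vector becomes a function on sets, with value 0 off the stable sets of size [d.+1]. *)
  pose D T := if (T \in stable_sets d.+1) =P true is ReflectT Td
              then w 0 (enum_rank_in Td T) else 0.
  have Dval t : D (enum_val t) = w 0 t.
    rewrite /D; case: eqP => [Td|]; last by rewrite enum_valP.
    by rewrite enum_valK_in.
  have D0 : forall T, T \in stable_sets d.+1 -> D T = 0.
    apply: inj => S Sd; have := congr1 (fun A : 'rV_ _ => A 0 (enum_rank_in Sd S)) wM0.
    rewrite !mxE => wS; rewrite -[RHS]wS [LHS]big_enum_val /=; apply: eq_bigr => t _.
    by rewrite !mxE enum_rankK_in // Dval mulrC.
  by apply/rowP => t; rewrite mxE -Dval D0 ?enum_valP.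
have /submxP[u uM] := submx_full (\row_t g@_(mnm_set (enum_val t))) fullM.
pose c S := if (S \in stable_sets d) =P true is ReflectT Sd
            then u 0 (enum_rank_in Sd S) else 0.
have cval s : c (enum_val s) = u 0 s.
  rewrite /c; case: eqP => [Sd|]; last by rewrite enum_valP.
  by rewrite enum_valK_in.
exists (setpoly d c); split; first exact: setpoly_homog.
apply: (mcoeff_in_J (d := d.+1)) => [|T Td].
  by apply: rpredB => //; apply/linformM_homog/setpoly_homog.
apply/eqP; rewrite mcoeffB subr_eq0 mcoeff_linformM.
have := congr1 (fun A : 'rV_ _ => A 0 (enum_rank_in Td T)) uM.
rewrite !mxE enum_rankK_in // => ->; apply/eqP.
transitivity (\sum_(S in stable_sets d) c S * incidence a S T).
  rewrite [RHS]big_enum_val /=; apply: eq_bigr => s _.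
  by rewrite mxE enum_rankK_in // cval.
rewrite sum_incidencel //; apply: eq_bigr => i iT.
by rewrite mcoeff_setpoly // stable_sets_setD1.
Qed.

End LinearAlgebra.

(** * Obstructions to maximal rank *)

Section Failure.
Variables (k : fieldType) (N : nat) (E : rel 'I_N).
Implicit Types (i j : 'I_N) (S T : {set 'I_N}).
Implicit Types (a w : 'I_N -> k) (c D : {set 'I_N} -> k).
Local Notation stable_sets := (stable_sets E).

(* If c is in the kernel of the sum of the variables, rescaling the variables gives
   the kernel element c S * prod_(i in S) a i for a form without zero coefficient.
   When a vanishes on Z, letting a i tend to 0 for i in Z leaves the terms with
   #|S :&: Z| minimal, divided by the power of the parameter. *)
Lemma mult_injective_ones d a :
  mult_injective E (linform a) d -> mult_injective E (linform (fun=> 1 : k)) d.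
Proof.
move=> /mult_injectiveP inj; apply/mult_injectiveP => c c0 S0 S0d.
have [//|cS0] := eqVneq (c S0) 0.
have [Z inZ] : exists Z : {set 'I_N}, forall i, (i \in Z) = (a i == 0).
  by exists [set i | a i == 0] => i; rewrite inE.
have setD1IZ T i : i \notin Z -> (T :\ i) :&: Z = T :&: Z.
  move=> iZ; apply/setP => j; rewrite !inE.
  by case: (eqVneq j i) => [->|//]; rewrite (negPf iZ) !andbF.
pose P S := (S \in stable_sets d) && (c S != 0).
have PS0 : P S0 by rewrite /P S0d.
case: (arg_minnP (fun S => #|S :&: Z|) PS0) => S1 /andP[S1d cS1] minS1.
pose c' S := if #|S :&: Z| == #|S1 :&: Z|
             then c S * \prod_(i in S :\: Z) a i else 0.
suff c'S1 : c' S1 = 0.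
  suff : c' S1 != 0 by rewrite c'S1 eqxx.
  rewrite /c' eqxx mulf_neq0 //; apply/prodf_neq0 => i.
  by rewrite inE inZ => /andP[].
apply: inj S1d => T Td; rewrite /c'.
have [eqTZ|neTZ] := eqVneq #|T :&: Z| #|S1 :&: Z|; last first.
  apply: big1 => i iT; have [|iZ] := boolP (i \in Z).
    by rewrite inZ => /eqP->; rewrite mul0r.
  by rewrite setD1IZ // (negPf neTZ) mulr0.
have := congr1 ( *%R^~ (\prod_(i in T :\: Z) a i)) (c0 T Td).
rewrite /= mul0r mulr_suml => sum0; apply: (etrans _ sum0).
apply: eq_bigr => i iT; rewrite mul1r; have [iZ|iZ] := boolP (i \in Z).
  (* Otherwise [T :\ i] would meet [Z] in fewer elements than [S1], against minimality. *)
  have -> : c (T :\ i) = 0.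
    apply/eqP/negPn/negP => cTi; have := minS1 (T :\ i).
    rewrite /P cTi (stable_sets_setD1 Td iT) -eqTZ => /(_ isT).
    by rewrite [X in (X <= _)%N](cardsD1 i) in_setI iT iZ setIDAC add1n ltnn.
  by move: iZ; rewrite inZ => /eqP->; rewrite !mul0r.
rewrite setD1IZ // eqTZ eqxx mulrCA; congr (_ * _).
rewrite [RHS](bigD1 i) /=; last by rewrite inE iZ.
congr (_ * _); apply: eq_bigl => j; rewrite !inE.
by rewrite -andbA; congr (_ && _); rewrite andbC.
Qed.

(** As [x] and [y] share a class, [T :\ x] and [T :\ y] meet the same classes. *)
Lemma dinjectiveb_setD1 (rT : eqType) (p : 'I_N -> rT) T x y :
  y \in T -> x != y -> p x = p y ->
  dinjectiveb p (T :\ x) -> dinjectiveb p (T :\ y).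
Proof.
move=> yT xy pxy /dinjectiveP pinj; apply/dinjectiveP => u v.
have yTx : y \in T :\ x by rewrite in_setD1 eq_sym xy.
rewrite !in_setD1 => /andP[uy uT] /andP[vy vT] puv.
have inTx z : z \in T -> z != x -> z \in T :\ x by rewrite in_setD1 => -> ->.
have [ux|ux] := eqVneq u x; have [vx|vx] := eqVneq v x.
- by rewrite ux vx.
- by case/eqP: vy; apply: pinj; rewrite ?yTx ?inTx // -puv ux.
- by case/eqP: uy; apply: pinj; rewrite ?yTx ?inTx // puv vx.
- by apply: pinj; rewrite ?yTx ?inTx.
Qed.

(* The class p i is a pair of cliques, told apart by the sign s i. *)
Lemma not_mult_injective d a (p : 'I_N -> 'I_d) (s : 'I_N -> bool) T0 :
  (forall i j, i != j -> p i = p j -> s i = s j -> E i j) ->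
  T0 \in stable_sets d -> {in T0 &, injective p} ->
  ~ mult_injective E (linform a) d.
Proof.
move=> Eps T0d pinj /mult_injective_ones/mult_injectiveP inj.
(* For [S] of size [d], the coefficient of [S] in the product over the [d] classes of the
   differences of the two clique sums: one vertex per class, with its sign. *)
pose c S : k := if dinjectiveb p S then \prod_(i in S) (-1) ^+ s i else 0.
have : c T0 != 0.
  rewrite /c; move/dinjectiveP: (pinj) => ->.
  by apply/prodf_neq0 => i _; rewrite signr_eq0.
rewrite (inj c) ?eqxx // => T Td {T0 T0d pinj inj}.
have [stT cT] : stable E T /\ #|T| = d.+1.
  by move: Td; rewrite inE => /andP[? /eqP].
(* Pigeonhole: [T] has [d.+1] vertices in [d] classes. As [T] is stable, two vertices in one class
   have opposite signs. *)
have /dinjectivePn[x xT [y]] : ~~ dinjectiveb p T.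
  apply/negP => /dinjectiveP/card_in_imset; rewrite cT => cp.
  by have := max_card (mem (p @: T)); rewrite cp card_ord ltnn.
rewrite inE /= => /andP[yx yT] pxy; have xy : x != y by rewrite eq_sym.
have sxy : s x != s y.
  apply/eqP => /(Eps x y xy pxy) Exy.
  by move/stableP: stT => /(_ x y xT yT xy); rewrite Exy.
rewrite (bigD1 x) //= (bigD1 y) /= ?yT //.
(* Removing any other vertex leaves [x] and [y] in one class, so that [c] vanishes; the two
   remaining terms differ only by their sign. *)
rewrite big1 => [|i /andP[/andP[iT ix] iy]]; last first.
  rewrite mul1r /c ifN //; apply/dinjectivePn; exists x.
    by rewrite in_setD1 xT eq_sym ix.
  by exists y => //; rewrite !inE yx yT eq_sym iy.
rewrite addr0 !mul1r /c; have -> : dinjectiveb p (T :\ y) = dinjectiveb p (T :\ x).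
  by apply/idP/idP; apply: dinjectiveb_setD1.
case: ifP => _; last by rewrite addr0.
rewrite (bigD1 y) ?in_setD1 ?yx //= [X in _ + X](bigD1 x) ?in_setD1 ?xy //=.
have -> : \prod_(i in T :\ y | i != x) (-1) ^+ s i =
          \prod_(i in T :\ x | i != y) (-1) ^+ s i :> k.
  by apply: eq_bigl => i; rewrite !in_setD1; do 2!case: eqP => _; rewrite ?andbF ?andbT.
rewrite -mulrDl; move: sxy; case: (s x) (s y) => -[] // _.
  by rewrite expr0 expr1 subrr mul0r.
by rewrite expr0 expr1 addNr mul0r.
Qed.

(** The dual form of class [z] is the sum of the [w i] e_i for [i] in [W] with [p i = z], and it
    pairs to 0 with the linear form. Since no edge joins two classes, the product of these [d.+1]
    forms lives on stable sets and is killed by the transpose; [h] picks nonzero coefficients, so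
    the product is nonzero. *)
Lemma not_mult_surjective d a (W : {set 'I_N}) (p : 'I_N -> 'I_d.+1) w
    (h : 'I_d.+1 -> 'I_N) :
  {in W &, forall i j, E i j -> p i = p j} ->
  (forall z, \sum_(i in W | p i == z) a i * w i = 0) ->
  (forall z, [/\ h z \in W, p (h z) = z & w (h z) != 0]) ->
  ~ mult_surjective E (linform a) d.
Proof.
move=> EWp aw0 hP /mult_surjectiveP surj.
have stW T : T \subset W -> {in T &, injective p} -> stable E T.
  move=> /subsetP TW pinj; apply/stableP => i j iT jT ij.
  apply: contra_neqN ij => Eij; apply: pinj => //.
  by apply: EWp; rewrite ?TW.
pose D T := if (T \subset W) && dinjectiveb p T then \prod_(i in T) w i else 0.
pose T0 := h @: setT.
have hinj : injective h.
  by move=> z z' hz; have [_ <- _] := hP z; rewrite hz; have [] := hP z'.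
have T0W : T0 \subset W by apply/subsetP => _ /imsetP[z _ ->]; have [] := hP z.
have pT0 : {in T0 &, injective p}.
  move=> _ _ /imsetP[z _ ->] /imsetP[z' _ ->].
  by have [_ -> _] := hP z; have [_ -> _] := hP z' => ->.
have T0d : T0 \in stable_sets d.+1.
  by rewrite inE stW //= card_imset // cardsT card_ord.
have : D T0 != 0.
  rewrite /D T0W; move/dinjectiveP: pT0 => ->; apply/prodf_neq0.
  by move=> _ /imsetP[z _ ->]; have [] := hP z.
rewrite (surj D) ?eqxx // => S Sd {T0 hinj T0W pT0 T0d surj}.
rewrite (sum_incidencer a D Sd).
have [stS cS] : stable E S /\ #|S| = d by move: Sd; rewrite inE => /andP[? /eqP].
case SWp: ((S \subset W) && dinjectiveb p S); last first.
  apply: big1 => i /andP[iS _]; rewrite /D ifF ?mulr0 //.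
  apply: contraFF SWp => /andP[iSW /dinjectiveP iSp].
  rewrite (subset_trans (subsetUr _ _) iSW); apply/dinjectiveP.
  by move=> x y xS yS; apply: iSp; rewrite in_setU1 ?xS ?yS orbT.
have /andP[SW /dinjectiveP Sp] := SWp.
(* [S] meets [d] of the [d.+1] classes; only vertices of the missing class [z] contribute, and they
   give a multiple of the vanishing sum of that class. *)
have [z zP] : exists z, ~: (p @: S) = [set z].
  apply/cards1P; rewrite -(eqn_add2l #|p @: S|) cardsC card_ord.
  by rewrite (card_in_imset Sp) cS addn1.
have pz x : (x \in ~: (p @: S)) = (x == z) by rewrite zP inE.
have := congr1 ( *%R (\prod_(i in S) w i)) (aw0 z).
rewrite /= mulr0 mulr_sumr => sum0; apply: (etrans _ sum0).
rewrite big_mkcond [RHS]big_mkcond /=; apply: eq_bigr => i _; rewrite -pz in_setC.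
have [iS|iS] /= := boolP (i \in S).
  by rewrite (imset_f p iS) andbF.
have [iW|iW] /= := boolP (i \in W); last first.
  by rewrite /D subUset sub1set (negPf iW) mulr0 if_same.
have [/imsetP[j jS pij]|piS] /= := boolP (p i \in p @: S).
  rewrite /D [dinjectiveb _ _](introF (dinjectiveP _ _)) ?andbF ?mulr0 ?if_same //.
  move=> iSp; have ij : i = j by apply: iSp; rewrite ?in_setU1 ?eqxx ?jS ?orbT.
  by rewrite ij jS in iS.
have iSW : i |: S \subset W by rewrite subUset sub1set iW.
have iSp : {in i |: S &, injective p}.
  move=> x y /setU1P[->|xS] /setU1P[->|yS] // pxy.
  - by rewrite pxy imset_f in piS.
  - by rewrite -pxy imset_f in piS.
  - exact: Sp.
rewrite inE stW // cardsU1 iS cS add1n eqxx /= /D iSW.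
by move/dinjectiveP: iSp => ->; rewrite big_setU1 //= [RHS]mulrC mulrA.
Qed.

(** On a pair (u, v) the weights (a_v, -a_u) are orthogonal to (a_u, a_v); when a_u = 0 the weights
    (1, 0) are taken instead, so that the dual form is never zero. *)
Lemma not_mult_surjective_pairs d a (p : 'I_N -> 'I_d.+1) (u v : 'I_d.+1 -> 'I_N) :
  cancel u p -> cancel v p -> (forall z, u z != v z) ->
  (forall z z', z != z' ->
    [&& ~~ E (u z) (u z'), ~~ E (u z) (v z'), ~~ E (v z) (u z') & ~~ E (v z) (v z')]) ->
  ~ mult_surjective E (linform a) d.
Proof.
move=> uK vK uv Euv; pose W := [set i | (i == u (p i)) || (i == v (p i))].
pose w i := if i == u (p i) then if a i == 0 then 1 else a (v (p i))
            else if a (u (p i)) == 0 then 0 else - a (u (p i)).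
have uW z : u z \in W by rewrite inE uK eqxx.
have vW z : v z \in W by rewrite inE vK eqxx orbT.
have wu z : w (u z) = if a (u z) == 0 then 1 else a (v z) by rewrite /w uK eqxx.
have wv z : w (v z) = if a (u z) == 0 then 0 else - a (u z).
  by rewrite /w vK eq_sym (negPf (uv z)).
pose h z := if a (u z) == 0 then u z else v z.
apply: (@not_mult_surjective d a W p w h) => [i j|z|z].
- rewrite !inE => iW jW Eij; apply/eqP/negPn/negP => /Euv.
  by case/orP: iW jW => /eqP <- /orP[] /eqP <-; rewrite Eij ?andbF.
- rewrite (bigD1 (u z)) ?uW ?uK //= (bigD1 (v z)) /=; last first.
    by rewrite vW vK eqxx eq_sym uv.
  rewrite big1 => [|i /andP[/andP[/andP[iW /eqP pi] iu] iv]].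
    rewrite addr0 wu wv; case: eqP => [->|_]; first by rewrite mul0r mulr0 addr0.
    by rewrite mulrN mulrC subrr.
  by move: iW; rewrite inE pi (negPf iu) (negPf iv).
- rewrite /h; case: (eqVneq (a (u z)) 0) => au; split; rewrite ?wu ?wv ?au ?eqxx //.
    exact: oner_neq0.
  by rewrite (negPf au) oppr_eq0.
Qed.

End Failure.

(** * The tadpole graph *)

Section TadpoleFailure.
Variables (k : fieldType) (m : nat).
Hypothesis m_ge3 : (3 <= m)%N.

(** The indices follow the path x_1, ..., x_m, y_1, y_2, the bridge joining [m.-1] and [m]. *)
Lemma tadpole_step (i j : 'I_(m + 2)) :
  i = j.+1 :> nat \/ j = i.+1 :> nat -> tadpole m 2 i j.
Proof.
have := ltn_ord i; have := ltn_ord j.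
rewrite /tadpole /tadpole_arc; lia.
Qed.

(** The bounds say d = ceil ((m + 2) / 4). A class is a block of four consecutive indices, split by
    [odd (i %/ 2)] into two edges of the path; the last block may be incomplete. *)
Lemma tadpole_not_injective (a : 'I_(m + 2) -> k) d :
  m <> 3 -> (m + 2 <= 4 * d)%N -> (4 * d <= m + 5)%N ->
  ~ mult_injective (tadpole m 2) (linform a) d.
Proof.
move=> m3 d_ge d_le.
have p_lt (i : 'I_(m + 2)) : (i %/ 4 < d)%N by have := ltn_ord i; lia.
(* A transversal of the blocks of four that avoids the edge from [0] to [m.-1]. *)
pose r (z : nat) := if z == 0%N then 1%N else (4 * z)%N.
have r_lt (z : 'I_d) : (r z < m + 2)%N.
  by have := ltn_ord z; rewrite /r; case: eqP => _; lia.
pose t z := Ordinal (r_lt z).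
have rP (z : nat) : r z = 1%N \/ r z = (4 * z)%N /\ (4 <= r z)%N.
  by rewrite /r; case: eqP; lia.
have rinj (x y : nat) : r x = r y -> x = y by rewrite /r; do 2!case: eqP => ?; lia.
apply: (@not_mult_injective _ _ _ d a (fun i => Ordinal (p_lt i))
  (fun i => odd (i %/ 2)) [set t z | z in setT]).
- move=> i j ij [pij] sij; apply: tadpole_step; move/eqP: ij => ij.
  have {}ij : nat_of_ord i <> j by move/val_inj.
  lia.
- have tinj : injective t.
    by move=> z z' /(congr1 val)/rinj/val_inj.
  rewrite inE card_imset // cardsT card_ord eqxx andbT.
  apply/stableP => _ _ /imsetP[z _ ->] /imsetP[z' _ ->] _.
  have := r_lt z; have := r_lt z'; have := rP z; have := rP z'.
  rewrite /tadpole /tadpole_arc /=; lia.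
- move=> _ _ /imsetP[z _ ->] /imsetP[z' _ ->] [] /= rz.
  suff -> : z = z' by []; apply: ord_inj; move: rz.
  by rewrite /r; do 2!case: eqP => ?; lia.
Qed.

(** Up to sign, the element killed by the sum of the variables is the sum over the triangle minus
    the sum over the edge {y_1, y_2}. *)
Lemma tadpole3_not_injective (a : 'I_(m + 2) -> k) :
  m = 3 -> ~ mult_injective (tadpole m 2) (linform a) 1.
Proof.
move=> m3; have lt0 : (0 < m + 2)%N by lia.
apply: (@not_mult_injective _ _ _ 1 a (fun=> ord0) (fun i => i < 3)%N
  [set Ordinal lt0]).
- move=> i j ij _ sij; have {}ij : nat_of_ord i <> j.
    by move=> /val_inj/eqP; apply/negP.
  have := ltn_ord i; have := ltn_ord j.
  rewrite /tadpole /tadpole_arc; lia.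
- rewrite inE cards1 andbT; apply/stableP => i j.
  by rewrite !inE => /eqP-> /eqP->; rewrite eqxx.
- by move=> i j; rewrite !inE => /eqP-> /eqP->.
Qed.

(** The pairs are {x_(3z+1), x_(3z+2)} for z < d, and {y_1, y_2}. As 3d <= m, the vertex x_m is in
    no pair, so neither the bridge nor the edge {x_m, x_1} joins two pairs. *)
Lemma tadpole_not_surjective (a : 'I_(m + 2) -> k) d :
  (3 * d <= m)%N -> ~ mult_surjective (tadpole m 2) (linform a) d.
Proof.
move=> d_le; pose q (e z : nat) := if (z == d)%N then (m + e)%N else (3 * z + e)%N.
have q_lt e (z : 'I_d.+1) : (e < 2 -> q e z < m + 2)%N.
  by have := ltn_ord z; rewrite /q; case: eqP; lia.
(* The cap by [d] acts only on vertices outside the pairs. *)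
have p_lt (i : 'I_(m + 2)) : ((if i < m then minn (i %/ 3) d else d) < d.+1)%N.
  by case: ifP => _; lia.
have pq (e z : nat) : (e < 2 -> z < d.+1 ->
    (if q e z < m then minn (q e z %/ 3) d else d) = z)%N.
  by rewrite /q; case: eqP; case: ifP; lia.
have qP (e z : nat) : q e z = (m + e)%N /\ z = d \/ q e z = (3 * z + e)%N /\ z <> d.
  by rewrite /q; case: eqP; [left | right].
have adj (e e' z z' : nat) : (e < 2 -> e' < 2 -> z < d.+1 -> z' < d.+1 -> z <> z' ->
    ~~ (tadpole_arc m (q e z) (q e' z') || tadpole_arc m (q e' z') (q e z)))%N.
  by have := qP e z; have := qP e' z'; rewrite /tadpole_arc; lia.
apply: (@not_mult_surjective_pairs _ _ _ d a (fun i => Ordinal (p_lt i))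
  (fun z => Ordinal (q_lt 0%N z isT)) (fun z => Ordinal (q_lt 1%N z isT))).
- by move=> z; apply: val_inj; apply: pq.
- by move=> z; apply: val_inj; apply: pq.
- by move=> z; apply/eqP => -[]; rewrite /q; case: eqP; lia.
- move=> z z' zz'; have {}zz' : nat_of_ord z <> z' by move/val_inj/eqP; apply/negP.
  by apply/and4P; split; apply: adj.
Qed.

Lemma tadpole_not_WLP : has_WLP k (tadpole m 2) -> m \in [:: 4; 5; 7; 8; 11]%N.
Proof.
move=> [a maxrank]; case: (eqVneq m 3) => [m3|/eqP m3].
  case: (maxrank 1%N) => [|/tadpole_not_surjective]; last by case; lia.
  by move/(tadpole3_not_injective m3).
(* The degree is ceil ((m + 2) / 4). For m > 3, the inequality 3d <= m fails only at the listed
   values. *)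
have [d_le|d_gt] := leqP (3 * ((m + 5) %/ 4)) m.
  case: (maxrank ((m + 5) %/ 4)%N) => [|/tadpole_not_surjective]; last by case.
  by move/tadpole_not_injective; case; lia.
rewrite !inE; lia.
Qed.

End TadpoleFailure.

(** * Certified elimination over the integers *)

Section Elimination.

(** A fraction-free elimination step; dividing the leading entries by their gcd keeps the integers
    small. *)
Definition reduce (p r : seq Z) : seq Z :=
  let: (a, b) := (head Z0 p, head Z0 r) in
  let: (a', b') := (Z.div a (Z.gcd a b), Z.div b (Z.gcd a b)) in
  [seq Z.sub (Z.mul a' xy.2) (Z.mul b' xy.1) | xy <- zip (behead p) (behead r)].

(* Each row is an equation in n unknowns; [true] certifies that only 0 solves them. *)
Fixpoint elim n (rows : seq (seq Z)) : bool :=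
  if n is n'.+1 then
    let pivots := [seq r <- rows | ~~ Z.eqb (head Z0 r) Z0] in
    let others := [seq behead r | r <- rows & Z.eqb (head Z0 r) Z0] in
    if pivots is p :: rest then elim n' (others ++ [seq reduce p r | r <- rest])
    else false
  else true.

Variable k : fieldType.
Hypothesis hk : [pchar k] =i pred0.

Definition Zto (z : Z) : k := (int_of_Z z)%:~R.

Lemma Zto0 : Zto Z0 = 0. Proof. by []. Qed.

Lemma ZtoM a b : Zto (Z.mul a b) = Zto a * Zto b.
Proof. by rewrite /Zto -intrM; congr (_%:~R); apply: (rmorphM int_of_Z). Qed.

Lemma ZtoB a b : Zto (Z.sub a b) = Zto a - Zto b.
Proof. by rewrite /Zto -intrB; congr (_%:~R); apply: (rmorphB int_of_Z). Qed.

(** Characteristic zero enters here: a nonzero integer pivot stays nonzero in [k]. *)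
Lemma Zto_eq0 z : (Zto z == 0) = Z.eqb z Z0.
Proof.
have natr_eq0 := (pcharf0P k).1 hk.
rewrite /Zto; have -> : Z.eqb z Z0 = (int_of_Z z == 0) by lia.
by case: (int_of_Z z) => n; rewrite ?NegzE ?mulrNz ?oppr_eq0 -?pmulrn natr_eq0.
Qed.

Definition dot (r : seq Z) (x : seq k) := \sum_(zy <- zip r x) Zto zy.1 * zy.2.

Lemma dot_cons z r y x : dot (z :: r) (y :: x) = Zto z * y + dot r x.
Proof. by rewrite /dot big_cons. Qed.

Lemma dot_lincomb a b p r x : size p = size r ->
  dot [seq Z.sub (Z.mul a xy.2) (Z.mul b xy.1) | xy <- zip p r] x =
  Zto a * dot r x - Zto b * dot p x.
Proof.
elim: p r x => [|z p IHp] [|z' r] [|y x] //= => [_|_|_|[pr]];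
  rewrite ?dot_cons ?(IHp _ _ pr) /dot ?big_nil ?mulr0 ?subr0 //.
rewrite ZtoB !ZtoM; ring.
Qed.

Lemma dot_reduce p r y x : size p = size r ->
  dot p (y :: x) = 0 -> dot r (y :: x) = 0 -> dot (reduce p r) x = 0.
Proof.
case: p r => [|a p] [|b r] //=; first by case: x => *; rewrite /dot big_nil.
case=> pr.
rewrite !dot_cons => /eqP; rewrite addrC addr_eq0 => /eqP px /eqP.
rewrite addrC addr_eq0 => /eqP rx; rewrite /reduce /= dot_lincomb // px rx.
(* The multipliers make the two terms in [y] equal, so they cancel. *)
rewrite !mulrN opprK !mulrA -!ZtoM Z.gcd_div_swap.
by rewrite [Z.mul (Z.div b _) a]Z.mul_comm addNr.
Qed.

Lemma dot_all0 r x : {in x, forall y, y = 0} -> dot r x = 0.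
Proof.
elim: x r => [|y x IHx] [|b r] x0; try by rewrite /dot big_nil.
rewrite dot_cons (x0 y) ?mem_head // mulr0 add0r; apply: IHx => u ux.
by apply: x0; rewrite inE ux orbT.
Qed.

(** Back substitution: the later unknowns vanish by induction, and the pivot equation, whose leading
    coefficient is nonzero in [k], then kills the first one. *)
Lemma elim_sound n rows (x : seq k) : elim n rows -> size x = n ->
  all (fun r => size r == n) rows -> {in rows, forall r, dot r x = 0} ->
  {in x, forall y, y = 0}.
Proof.
elim: n rows x => [|n IHn] rows [|y x] //= elim_ok [sx] /allP szr dot0.
set others := [seq behead r | r <- _ & _] in elim_ok.
case Dpiv: [seq r <- rows | ~~ _] elim_ok => [//|p rest] elim_ok.
have : p \in p :: rest by rewrite inE eqxx.
rewrite -Dpiv mem_filter => /andP[p0 prows].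
have x0 : {in x, forall y, y = 0}.
  apply: IHn elim_ok sx _ _.
    rewrite all_cat; apply/andP; split; apply/allP => _ /mapP[r rin ->].
      by move: rin; rewrite mem_filter size_behead => /andP[_ /szr/eqP->].
    have /szr/eqP sr : r \in rows.
      have : r \in p :: rest by rewrite inE rin orbT.
      by rewrite -Dpiv mem_filter => /andP[].
    rewrite size_map size_zip !size_behead sr (eqP (szr _ prows)) /=.
    by rewrite minnn.
  move=> _ /[!mem_cat] /orP[] /mapP[r rin ->].
    move: rin; rewrite mem_filter => /andP[/Z.eqb_eq r0 rrows].
    have := dot0 _ rrows; have := szr _ rrows; case: r r0 {rrows} => [|z r] //= -> _.
    by rewrite dot_cons Zto0 mul0r add0r.
  have rrows : r \in rows.
    have : r \in p :: rest by rewrite inE rin orbT.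
    by rewrite -Dpiv mem_filter => /andP[].
  apply: (dot_reduce _ (dot0 _ prows) (dot0 _ rrows)).
  by rewrite (eqP (szr _ prows)) (eqP (szr _ rrows)).
move=> z; rewrite inE => /orP[/eqP->|]; last exact: x0.
have := dot0 _ prows; have := szr _ prows; case: p p0 {prows Dpiv elim_ok} => //= a p a0 _.
rewrite dot_cons dot_all0 //.
by rewrite addr0 => /eqP; rewrite mulf_eq0 Zto_eq0 (negPf a0) => /eqP.
Qed.

End Elimination.

(** * Computable enumeration of stable sets as lists *)

Section ListModel.
Variable e : rel nat.

Fixpoint stable_seqs (l : seq nat) d : seq (seq nat) :=
  if l is x :: l' then
    (if d is d'.+1 then [seq x :: s | s <- stable_seqs l' d' & all (fun y => ~~ e x y) s]
     else [::]) ++ stable_seqs l' d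
  else if d is 0 then [:: [::]] else [::].

Lemma mem_stable_seqs l d s : uniq l ->
  (s \in stable_seqs l d) =
  [&& subseq s l, pairwise (fun x y => ~~ e x y) s & size s == d].
Proof.
elim: l d s => [|x l IHl] d s /=; first by case: d s => [|d] [|y s] //=; rewrite inE.
case/andP=> xl ul; rewrite mem_cat IHl //.
have consE :
    (s \in if d is d'.+1
           then [seq x :: s | s <- stable_seqs l d' & all (fun y => ~~ e x y) s]
           else [::])
  = if s is y :: s'
    then [&& y == x, subseq s' l, pairwise (fun x y => ~~ e x y) s & size s == d]
    else false.
  case: d s => [|d] [|y s] //=; rewrite ?in_nil ?andbF //.
    by apply/mapP => -[].
  apply/mapP/and4P => [[s' + [-> ->]]|[/eqP-> sl /andP[al ps] szs]].
    rewrite mem_filter IHl // => /and4P[al sl ps szs].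
    by rewrite eqxx al sl ps.
  by exists s => //; rewrite mem_filter al IHl // sl ps.
rewrite {}consE; case: s => [|y s] /=; first by rewrite sub0seq.
case: (eqVneq y x) => [->|] //=.
have -> : subseq (x :: s) l = false.
  by apply: contraNF xl => /mem_subseq; apply; rewrite mem_head.
by rewrite orbF.
Qed.

Lemma stable_seqs_uniq l d : uniq l -> uniq (stable_seqs l d).
Proof.
elim: l d => [|x l IHl] [|d] //= /andP[xl ul]; first exact: IHl.
rewrite cat_uniq IHl // andbT map_inj_uniq => [|s t [] //].
rewrite filter_uniq ?IHl //=; apply/hasPn => s; rewrite mem_stable_seqs // => /and3P[sl _ _].
apply: contraNN xl => /mapP[t _ st]; move: sl; rewrite st => /mem_subseq; apply.
exact: mem_head.
Qed.

(* The last equation is used as the pivot ([rev]): this keeps the coefficients small. *)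
Definition full_rank_check (l : seq nat) d : bool :=
  let: (A, B) := (stable_seqs l d, stable_seqs l d.+1) in
  if (size A <= size B)%N
  then elim (size A) (rev [seq [seq Z.b2z (subseq s t) | s <- A] | t <- B])
  else elim (size B) (rev [seq [seq Z.b2z (subseq s t) | t <- B] | s <- A]).

Variables (N : nat) (E : rel 'I_N).
Hypotheses (Ee : forall i j, E i j = e i j) (Esym : forall i j, E i j = E j i).
Implicit Types (i j : 'I_N) (S T : {set 'I_N}).

(** [enum S] is increasing, so codes are subsequences of [iota 0 N] and inclusion of sets becomes
    [subseq]. *)
Definition code S : seq nat := [seq val i | i <- enum S].
Definition decode (s : seq nat) : {set 'I_N} := [set i | val i \in s].

Lemma mem_code S i : (val i \in code S) = (i \in S).
Proof. by rewrite mem_map ?mem_enum //; apply: val_inj. Qed.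

Lemma codeK : cancel code decode.
Proof. by move=> S; apply/setP => i; rewrite inE mem_code. Qed.

Lemma subseq_code S T : subseq (code S) (code T) = (S \subset T).
Proof.
apply/idP/idP => [/mem_subseq sST|/subsetP sST].
  by apply/subsetP => i; rewrite -!mem_code; apply: sST.
apply: map_subseq; have -> : enum S = filter (mem S) (enum T); last exact: filter_subseq.
rewrite /enum_mem -filter_predI; apply: eq_filter => i /=.
by case: (boolP (i \in S)) => //= /sST ->.
Qed.

Lemma subseq_code_iota S : subseq (code S) (iota 0 N).
Proof.
rewrite -val_enum_ord; have -> : [seq val i | i <- enum 'I_N] = code setT.
  by rewrite /code; congr map; apply: eq_enum => i; rewrite !inE.
by rewrite subseq_code subsetT.
Qed.

(** [pairwise] tests each pair in one order only; the symmetry of [E] gives the other. *)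
Lemma stable_code S : stable E S = pairwise (fun x y => ~~ e x y) (code S).
Proof.
rewrite pairwise_map; apply/stableP/idP => [st|].
  have : pairwise (fun i j => i != j) (enum S) by rewrite -uniq_pairwise enum_uniq.
  apply: (@sub_in_pairwise _ (mem S)); last by apply/allP => i; rewrite mem_enum.
  by move=> i j iS jS ij /=; rewrite -Ee st.
move=> pw i j; rewrite -(mem_enum S i) -(mem_enum S j); move: pw.
elim: (enum S) => //= x s IHs /andP[/allP xs ps].
rewrite !inE => /orP[/eqP->|iS] /orP[/eqP->|jS]; first by rewrite eqxx.
- by move=> _; rewrite Ee; apply: xs.
- by move=> _; rewrite Esym Ee; apply: xs.
- exact: IHs.
Qed.

Lemma perm_code d :
  perm_eq [seq code T | T <- enum (stable_sets E d)] (stable_seqs (iota 0 N) d).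
Proof.
apply: uniq_perm; rewrite ?stable_seqs_uniq ?iota_uniq //.
  by rewrite map_inj_uniq ?enum_uniq //; apply: can_inj codeK.
move=> s; rewrite mem_stable_seqs ?iota_uniq //.
apply/mapP/and3P => [[S0 + ->]|[sN ps /eqP sd]].
  rewrite mem_enum inE => /andP[stS /eqP cS].
  by rewrite subseq_code_iota -stable_code size_map -cardE cS.
have sE : s = code (decode s).
  have us : uniq s := subseq_uniq sN (iota_uniq 0 N).
  move/subseq_uniqP: sN => /(_ (iota_uniq 0 N)) {1}->.
  rewrite -val_enum_ord filter_map; congr map.
  by rewrite [RHS]/enum_mem -enumT; apply: eq_filter => i; rewrite /= inE.
exists (decode s) => //; rewrite mem_enum inE stable_code -sE ps.
by rewrite cardE -(size_map val) -/(code (decode s)) -sE sd eqxx.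
Qed.

Lemma sum_stable_sets (R : nmodType) d (F : seq nat -> R) :
  \sum_(S in stable_sets E d) F (code S) = \sum_(s <- stable_seqs (iota 0 N) d) F s.
Proof. by rewrite -(perm_big _ (perm_code d)) big_map big_enum. Qed.

Variable k : fieldType.
Hypothesis hk : [pchar k] =i pred0.

(** When [S \subset T], the difference is a single vertex, which contributes 1. *)
Lemma incidence_ones d S T : S \in stable_sets E d -> T \in stable_sets E d.+1 ->
  incidence (fun=> 1 : k) S T = (S \subset T)%:R.
Proof.
rewrite !inE => /andP[_ /eqP cS] /andP[_ /eqP cT].
have D1E i : (i \in T) && (T :\ i == S) = (S \subset T) && (i \in T :\: S).
  apply/andP/andP => [[iT /eqP <-]|[sST]].
    by rewrite subsetDl !inE eqxx iT.
  rewrite inE => /andP[iS iT]; split=> //.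
  have cTi : #|T :\ i| = d by move: cT; rewrite (cardsD1 i) iT add1n => -[].
  by rewrite eq_sym eqEcard subsetD1 sST iS cS cTi /=.
rewrite /incidence (eq_bigl _ _ D1E) sumr_const.
case: (boolP (S \subset T)) => sST /=; last by rewrite (@eq_card0 _ _).
rewrite (@eq_card _ _ (mem (T :\: S))) // cardsD (setIidPr sST) cS cT.
by rewrite subSnn.
Qed.

Lemma dot_stable_seqs d (c : {set 'I_N} -> k) (b : seq nat -> bool) :
  dot [seq Z.b2z (b s) | s <- stable_seqs (iota 0 N) d]
      [seq c (decode s) | s <- stable_seqs (iota 0 N) d] =
  \sum_(S in stable_sets E d) (b (code S))%:R * c S.
Proof.
under eq_bigr => T _ do rewrite -{2}(codeK T).
rewrite (sum_stable_sets d (fun s => (b s)%:R * c (decode s))) /dot zip_map big_map.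
by apply: eq_bigr => s _ /=; case: (b s).
Qed.

(** Leaving [b] free lets one statement serve both the multiplication map and its transpose. *)
Lemma elim_stable_seqs d d' (b : seq nat -> seq nat -> bool) (c : {set 'I_N} -> k) :
  elim (size (stable_seqs (iota 0 N) d))
    (rev [seq [seq Z.b2z (b s t) | s <- stable_seqs (iota 0 N) d]
         | t <- stable_seqs (iota 0 N) d']) ->
  (forall T, T \in stable_sets E d' ->
     \sum_(S in stable_sets E d) (b (code S) (code T))%:R * c S = 0) ->
  forall S, S \in stable_sets E d -> c S = 0.
Proof.
move=> elim_ok c0 S Sd; pose x := [seq c (decode s) | s <- stable_seqs (iota 0 N) d].
apply: (elim_sound hk elim_ok (x := x)); first by rewrite size_map.
- by apply/allP => r; rewrite mem_rev => /mapP[t _ ->]; rewrite size_map.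
- move=> r; rewrite mem_rev => /mapP[t]; rewrite -(perm_mem (perm_code d')).
  by case/mapP=> T; rewrite mem_enum => Td -> ->; rewrite dot_stable_seqs c0.
- apply/mapP; exists (code S); last by rewrite codeK.
  by rewrite -(perm_mem (perm_code d)) map_f // mem_enum.
Qed.

Lemma full_rank_check_sound d : full_rank_check (iota 0 N) d ->
  mult_injective E (linform (fun=> 1 : k)) d \/
  mult_surjective E (linform (fun=> 1 : k)) d.
Proof.
rewrite /full_rank_check; case: ifP => _ elim_ok; [left | right].
  apply/mult_injectiveP => c c0; apply: (elim_stable_seqs elim_ok) => T Td.
  rewrite -[RHS](c0 T Td) -(sum_incidencel (fun=> 1) c Td); apply: eq_bigr => S Sd.
  by rewrite subseq_code (incidence_ones Sd Td) mulrC.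
apply/mult_surjectiveP => D D0.
apply: (elim_stable_seqs (b := fun t s => subseq s t) elim_ok) => S Sd.
rewrite -[RHS](D0 S Sd); apply: eq_bigr => T Td.
by rewrite subseq_code (incidence_ones Sd Td).
Qed.

(** There are no stable sets of size [b] or more, so from degree [b] on the target is zero and the
    map is onto; the check covers the lower degrees. *)
Lemma full_rank_WLP b :
  nilp (stable_seqs (iota 0 N) b) -> all (full_rank_check (iota 0 N)) (iota 0 b) ->
  has_WLP k E.
Proof.
move=> /nilP gen0 /allP ok; exists (fun=> 1) => d.
have [lt_db|le_bd] := ltnP d b.
  by apply: full_rank_check_sound; apply: ok; rewrite mem_iota.
have ind0 : stable_sets E b = set0.
  apply/setP => S; rewrite in_set0; apply/negP => Sb.
  have : code S \in stable_seqs (iota 0 N) b.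
    by rewrite -(perm_mem (perm_code b)) map_f // mem_enum.
  by rewrite gen0.
right; apply/mult_surjectiveP => D _ T.
by rewrite -(subnKC (leqW le_bd)) (stable_sets_eq0_add _ ind0) in_set0.
Qed.

End ListModel.

(** * Maximal rank in the five remaining cases, and the equivalence *)

Section TadpoleWLP.
Variable k : fieldType.
Hypothesis hk : [pchar k] =i pred0.

Lemma tadpole_WLP m b :
  let e u v := tadpole_arc m u v || tadpole_arc m v u in
  let l := iota 0 (m + 2)%N in
  nilp (stable_seqs e l b) && all (full_rank_check e l) (iota 0 b) -> has_WLP k (tadpole m 2).
Proof.
move=> e l /andP[gen0 ok]; apply: (full_rank_WLP (e := e)) gen0 ok => //.
by move=> i j; apply: orbC.
Qed.

End TadpoleWLP.

Theorem theorem4p1 (k : fieldType) (hk : ([pchar k] =i pred0)%R)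
    (m : nat) (hm : (3 <= m)%N) :
  has_WLP k (tadpole m 2) <-> m \in [:: 4; 5; 7; 8; 11]%N.
Proof.
split; first exact: tadpole_not_WLP.
rewrite !inE => /or4P[/eqP->|/eqP->|/eqP->|/orP[/eqP->|/eqP->]].
(* Each [b] is floor (m / 2) + 2, one more than the largest size of a stable set. *)
- by apply: (tadpole_WLP hk (b := 4)); vm_compute.
- by apply: (tadpole_WLP hk (b := 4)); vm_compute.
- by apply: (tadpole_WLP hk (b := 5)); vm_compute.
- by apply: (tadpole_WLP hk (b := 6)); vm_compute.
- by apply: (tadpole_WLP hk (b := 7)); vm_compute.
Qed.
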